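(* Let $c_1, c_2$ be rational numbers with $0 \le c_1, c_2 \le 1$, and let $G$ be a $(c_1,c_2)$-mixed graph with $n$ vertices. If $$\delta(G) \ge \frac{1}{2-c_1-c_2}\, n + \frac{2}{2-c_1-c_2}\cdot \frac{\ln n}{\ln \frac{4}{3}},$$ then $\overrightarrow{\mathrm{diam}}(G) = 2$.
   Context: A mixed graph $G$ has a finite vertex set $V(G)$ and an edge set $E(G)$ consisting of undirected edges $xy$ and directed edges (arcs) $\overrightarrow{xy}$; there are no loops and no parallel edges. For $x \in V(G)$: $N^+_G(x)=\{y : \overrightarrow{xy}\in E(G)\}$, $N^-_G(x)=\{y:\overrightarrow{yx}\in E(G)\}$, $N^0_G(x)=\{y: xy\in E(G)\}$, $N_G(x)=N^+_G(x)\cup N^-_G(x)\cup N^0_G(x)$; the degree is $d_G(x)=|N_G(x)|$, the out-degree $d^+_G(x)=|N^+_G(x)|$, the in-degree $d^-_G(x)=|N^-_G(x)|$, and $\delta(G)$ is the minimum degree. For rational numbers $0\le c_1,c_2\le 1$, $G$ is a $(c_1,c_2)$-mixed graph if $d^+_G(u)\le c_1 d_G(u)$ and $d^-_G(u)\le c_2 d_G(u)$ for every $u\in V(G)$. An orientation of $G$ is a directed graph obtained by assigning a direction to every undirected edge of $G$ (directed edges keep their direction). The oriented diameter $\overrightarrow{\mathrm{diam}}(G)$ is the minimum, over all strongly connected orientations $D$ of $G$, of the diameter of $D$ (the maximum over ordered pairs of distinct vertices $(u,v)$ of the length of a shortest directed path from $u$ to $v$ in $D$). *)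

(* Defs.v *)
From mathcomp Require Import all_boot all_order all_algebra.
From mathcomp Require Import reals exp.

Set Implicit Arguments.
Unset Strict Implicit.
Unset Printing Implicit Defensive.

Import Order.TTheory GRing.Theory Num.Theory.

(* "No parallel edges" is read as: two vertices are joined by at most one edge,
   undirected or directed, so opposite arcs are excluded as well.               *)
Record mixed_graph := MixedGraph {
  vertex :> finType;
  edge : rel vertex;
  arc : rel vertex;
  edge_sym : symmetric edge;
  edge_irrefl : irreflexive edge;
  arc_irrefl : irreflexive arc;
  arc_asym : forall x y, arc x y -> ~~ arc y x;
  edge_arc_disjoint : forall x y, edge x y -> ~~ arc x y
}.

Section MixedGraph.

Variable G : mixed_graph.

Definition out_nbh (x : G) : {set G} := [set y | arc x y].
Definition in_nbh (x : G) : {set G} := [set y | arc y x].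
Definition und_nbh (x : G) : {set G} := [set y | edge x y].
Definition nbh (x : G) : {set G} := out_nbh x :|: in_nbh x :|: und_nbh x.

Definition outdeg (x : G) : nat := #|out_nbh x|.
Definition indeg (x : G) : nat := #|in_nbh x|.
Definition deg (x : G) : nat := #|nbh x|.

(* Every degree is less than #|G|, so the default value #|G| matters only when
   G is empty.                                                                  *)
Definition min_degree : nat := \big[minn/#|G|]_(x : G) deg x.

Definition c_mixed (c1 c2 : rat) : Prop :=
  forall u : G, ((outdeg u)%:R <= c1 * (deg u)%:R)%R /\
                ((indeg u)%:R <= c2 * (deg u)%:R)%R.

End MixedGraph.

(* A directed graph on V is given by its set of arcs D. *)
Section Digraph.

Variables (V : finType) (D : {set V * V}).

Definition darc : rel V := [rel x y | (x, y) \in D].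

Definition strongly_connected : bool :=
  [forall x, forall y, connect darc x y].

Definition dpath_of_length (u v : V) (k : nat) : bool :=
  [exists p : k.-tuple V,
     [&& path darc u p, uniq (u :: p) & last u p == v]].

(* A path has length less than #|V|; the value is #|V| when v cannot be reached
   from u.                                                                      *)
Definition ddist (u v : V) : nat :=
  find (dpath_of_length u v) (iota 0 #|V|).

Definition diameter : nat := \max_(u : V) \max_(v : V | u != v) ddist u v.

End Digraph.

Section Orientation.

Variable G : mixed_graph.

Definition orientation (D : {set G * G}) : bool :=
  [forall x, forall y,
     if edge x y then ((x, y) \in D) (+) ((y, x) \in D)
     else ((x, y) \in D) == arc x y].

Definition strong_orientation (D : {set G * G}) : bool :=
  orientation D && strongly_connected D.

(* None when G has no strongly connected orientation. *)
Definition oriented_diameter : option nat :=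
  if [pick D | strong_orientation D] is Some D0
  then Some (diameter [arg min_(D < D0 | strong_orientation D) diameter D])
  else None.

End Orientation.

(* Main.v *)
(* Orient every undirected edge by an independent fair coin.  For u != v let W
   be the set of vertices w with u -> w or u - w, and w -> v or w - v; the
   degree hypothesis gives |W| >= 2 ln n / ln (4/3).  The pairs of coins on
   {u,w} and {w,v} are disjoint for distinct w, so no w in W becomes a midpoint
   of a path u -> w -> v with probability at most (3/4)^|W| <= n^-2.  A union
   bound over the n(n-1) ordered pairs leaves an orientation of diameter at most
   2, and an antisymmetric relation never has diameter 1. *)
Require Import Defs.
From mathcomp Require Import all_boot all_order all_algebra.
From mathcomp Require Import reals exp.
From mathcomp Require Import zify lra.

Import Order.TTheory GRing.Theory Num.Theory.
Local Open Scope ring_scope.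

(** * Counting coin outcomes that avoid prescribed values on disjoint pairs of coins *)

Section Coins.

Local Open Scope nat_scope.

Context {I : finType}.
Implicit Types (f : {set I}) (A : {set {set I}}) (i j : I).

Definition flip i f : {set I} := [set j | (j \in f) (+) (j == i)].

Lemma flipK i : involutive (flip i).
Proof. by move=> f; apply/setP => j; rewrite !inE -addbA addbb addbF. Qed.

(** Flipping coin [i] is an involution that preserves [A] and exchanges its members with heads at
    [i] and those with tails. *)
Lemma card_coin A i (b : bool) :
  (forall f, (flip i f \in A) = (f \in A)) ->
  #|A| = 2 * #|[set f : {set I} in A | (i \in f) == b]|.
Proof.
move=> hA; rewrite -(cardsID [set f : {set I} | (i \in f) == b] A) mul2n -addnn.
congr (_ + _); first by apply: eq_card => f; rewrite !inE.
rewrite -(card_imset _ (inv_inj (flipK i))); apply: eq_card => f.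
rewrite -{1}(flipK i f) (mem_imset _ _ (inv_inj (flipK i))) !inE hA eqxx addbT.
by rewrite andbC; case: (i \in f); case: b.
Qed.

(** This is the probability bound [(3/4)^(size s)] cleared of denominators. In the induction, the
    condition on the tail ignores both coins of the head [t]; they split its solutions into four
    equal classes, one of which is lost. *)
Lemma card_avoid_coin_pairs (T : eqType) (s : seq T) (a b : T -> I)
    (x y : T -> bool) :
  uniq s -> injective a -> injective b ->
  {in s &, forall t t', a t != b t'} ->
  4 ^ size s *
    #|[set f : {set I} |
        all (fun t => ~~ (((a t \in f) == x t) && ((b t \in f) == y t))) s]|
  <= 3 ^ size s * 2 ^ #|I|.
Proof.
move=> + inja injb; elim: s => [_ _|t s IHs /= /andP[ts us] hab].
  by rewrite !mul1n (leq_trans (max_card _)) // -cardsT -powersetT card_powerset cardsT.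
set P := fun (f : {set I}) t => ~~ (((a t \in f) == x t) && ((b t \in f) == y t)).
have /IHs-/(_ us) {}IHs : {in s &, forall t t', a t != b t'}.
  by move=> t1 t2 h1 h2; apply: hab; rewrite inE ?h1 ?h2 orbT.
set A := [set f : {set I} | all (P f) s] in IHs *.
have flipA i : (forall t', t' \in s -> (a t' != i) && (b t' != i)) ->
    forall f, (flip i f \in A) = (f \in A).
  move=> hi f; rewrite !inE; apply: eq_in_all => t' /hi/andP[ha hb].
  by rewrite /P !inE (negbTE ha) (negbTE hb) !addbF.
have ne t' : t' \in s -> t' != t by move=> h; apply: contraNneq ts => <-.
have flipa : forall f, (flip (a t) f \in A) = (f \in A).
  apply: flipA => t' h; rewrite (inj_eq inja) ne //= eq_sym hab //.
    by rewrite mem_head.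
  by rewrite inE h orbT.
have flipb : forall f, (flip (b t) f \in A) = (f \in A).
  apply: flipA => t' h; rewrite (inj_eq injb) ne // andbT hab //.
    by rewrite inE h orbT.
  by rewrite mem_head.
have ab : a t != b t by rewrite hab ?mem_head.
have cA := card_coin A (a t) (x t) flipa.
set A' := [set f : {set I} in A | _] in cA.
(* [B] is the quarter of [A] where both coins of [t] take the forbidden values; flipping [b t]
   preserves [A'] because [a t != b t]. *)
have := card_coin A' (b t) (y t); set B := [set f : {set I} in A' | _] => cB.
have {}cB : #|A'| = 2 * #|B|.
  by apply: cB => f; rewrite ![_ \in A']inE flipb [a t \in flip _ _]inE (negbTE ab) addbF.
set C := [set f | _].
have cAC : #|A| = #|B| + #|C|.
  rewrite -(cardsID B A); congr (_ + _); apply: eq_card => f; rewrite !inE /P.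
    by case: all => //=; rewrite ?andbF.
  by rewrite -/(P f); case: (all (P f) s); rewrite ?andbF ?andbT.
have C4 : 4 * #|C| = 3 * #|A| by move: cAC; rewrite cA cB; lia.
by rewrite !expnS [4 * _]mulnC -!mulnA C4 mulnCA leq_mul.
Qed.

End Coins.

(** * Comparing distances and the diameter with 2 *)

Section Distance.

Local Open Scope nat_scope.

Variables (V : finType) (D : {set V * V}).

Lemma ddist_le2 (u v w : V) :
  u != v -> w != u -> w != v -> (u, w) \in D -> (w, v) \in D -> ddist D u v <= 2.
Proof.
move=> uv wu wv uw wvD; rewrite leqNgt; apply/negP => lt.
have := @before_find _ 0 (dpath_of_length D u v) (iota 0 #|V|) 2 lt.
(* A search that passes index 2 runs through a list longer than 2, so length 2 was really tested. *)
have s2 : 2 < #|V|.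
  by apply: leq_trans lt _; rewrite -[leqRHS](size_iota 0) find_size.
rewrite nth_iota // => /negbT/negP[]; apply/existsP; exists [tuple w; v] => /=.
by rewrite /darc /= uw wvD !inE eqxx negb_or eq_sym wu uv wv.
Qed.

Lemma ddist_ge2 (u v : V) : u != v -> (u, v) \notin D -> 2 <= ddist D u v.
Proof.
move=> uv uvD.
(* With two vertices the default value [#|V|] is at least 2, so a distance below 2 comes from an
   actual path of length 0 or 1. *)
have n1 : 1 < #|V| by rewrite (cardD1 u) (cardD1 v) !inE eq_sym uv.
rewrite leqNgt; apply/negP => lt.
have h : has (dpath_of_length D u v) (iota 0 #|V|).
  by rewrite has_find size_iota (leq_trans lt).
have := nth_find 0 h; rewrite -/(ddist D u v) nth_iota; last exact: leq_trans lt _.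
rewrite add0n; case: (ddist D u v) lt => [|[|//]] _ /existsP[p].
  by rewrite (tuple0 p) /= (negbTE uv).
case: p => -[|z []] //= _; rewrite /darc /= => /and3P[/andP[uz _] _ /eqP zv].
by rewrite -zv uz in uvD.
Qed.

(** For two distinct vertices, one of the two ordered pairs is not an arc, and [ddist_ge2] applies
    to it. *)
Lemma diameter_ge2 :
  (forall x y, (x, y) \in D -> (y, x) \notin D) -> 1 < #|V| -> 2 <= diameter D.
Proof.
move=> asym /card_gt1P[u [v [_ _ uv]]].
wlog uvD : u v uv / (u, v) \notin D.
  move=> hw; have [/asym vuD|] := boolP ((u, v) \in D); last exact: hw.
  by apply: (hw v u); rewrite 1?eq_sym.
apply: leq_trans (ddist_ge2 _ _ uv uvD) _.
have le_row : ddist D u v <= \max_(y | u != y) ddist D u y.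
  exact: leq_bigmax_cond.
apply: leq_trans le_row _.
exact: (@leq_bigmax _ (fun x => \max_(y | x != y) ddist D x y)).
Qed.

End Distance.

(** * Random orientations and the union bound *)

Section RandomOrientation.

Variable G : mixed_graph.
Implicit Types (u v w x y : G) (f : {set {set G}}).

(* [f] is the set of vertex pairs whose coin shows heads; the comparison of ranks
   makes [toward f] antisymmetric. It is defined on all pairs, adjacent or not,
   so that arcs need no separate treatment in the counting. *)
Definition toward f x y : bool :=
  ([set x; y] \in f) (+) (enum_rank x < enum_rank y)%N.

(* The unqualified name [arc] denotes the sub-arc of a cycle from [path]. *)
Definition orient f : {set G * G} :=
  [set e : G * G | Defs.arc e.1 e.2 || edge e.1 e.2 && toward f e.1 e.2].

Lemma towardC f x y : x != y -> toward f y x = ~~ toward f x y.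
Proof.
move=> xy; rewrite /toward setUC -addbN; congr (_ (+) _).
by rewrite -leqNgt ltn_neqAle (inj_eq val_inj) (inj_eq enum_rank_inj) eq_sym xy.
Qed.

Lemma edge_neq x y : edge x y -> x != y.
Proof. by apply: contraTneq => ->; rewrite edge_irrefl. Qed.

Lemma arc_neq x y : Defs.arc x y -> x != y.
Proof. by apply: contraTneq => ->; rewrite arc_irrefl. Qed.

Lemma orient_orientation f : orientation (orient f).
Proof.
apply/forallP => x; apply/forallP => y; rewrite !inE /=.
case: ifP => [e|ne]; last by rewrite ne orbF.
have /negbTE nxy := edge_arc_disjoint e.
have e' : edge y x by rewrite edge_sym.
have /negbTE nyx := edge_arc_disjoint e'.
by rewrite nxy nyx e e' /= (towardC f) ?edge_neq //; case: toward.
Qed.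

Lemma orientation_asym (D : {set G * G}) x y :
  orientation D -> (x, y) \in D -> (y, x) \notin D.
Proof.
move=> /forallP oD xyD; have /forallP/(_ y) := oD x; have /forallP/(_ x) := oD y.
case: ifP => [e|ne]; first by rewrite xyD addbT.
by rewrite edge_sym ne xyD => /eqP-> /eqP/esym/arc_asym.
Qed.

Definition midpoints u v : {set G} :=
  (out_nbh u :|: und_nbh u) :&: (in_nbh v :|: und_nbh v).

Lemma midpoint_neq u v w : w \in midpoints u v -> (w != u) && (w != v).
Proof.
rewrite !inE => /andP[h1 h2]; apply/andP; split.
  by case/orP: h1 => [/arc_neq|/edge_neq]; rewrite eq_sym.
by case/orP: h2 => [/arc_neq|/edge_neq]; rewrite // eq_sym.
Qed.

Lemma midpoint_path f u v w :
  w \in midpoints u v -> toward f u w -> toward f w v ->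
  ((u, w) \in orient f) && ((w, v) \in orient f).
Proof.
by rewrite !inE /= (edge_sym v w) => /andP[h1 h2] -> ->; rewrite !andbT h1.
Qed.

(** The coins must point the right way even along arcs, where [orient] ignores them. Escaping
    [blocked u v] thus suffices for a path through a midpoint, and every midpoint contributes the
    same factor 3/4. *)
Definition blocked u v : {set {set {set G}}} :=
  [set f | [forall w in midpoints u v, ~~ (toward f u w && toward f w v)]].

Lemma card_blocked u v : u != v ->
  (4 ^ #|midpoints u v| * #|blocked u v|
   <= 3 ^ #|midpoints u v| * 2 ^ #|{: {set G}}|)%N.
Proof.
move=> uv.
(* As [toward] is an exclusive or with the rank comparison, it holds exactly when the coin equals
   the negated comparison. *)
have := @card_avoid_coin_pairs _ _ (enum (midpoints u v)) (fun w => [set u; w])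
  (fun w => [set w; v]) (fun w => ~~ (enum_rank u < enum_rank w)%N)
  (fun w => ~~ (enum_rank w < enum_rank v)%N) (enum_uniq _).
have injl z : injective (fun w : G => [set z; w]).
  move=> w w' /setP e; have := e w; have := e w'; rewrite !inE !eqxx !orbT.
  by move=> /orP[/eqP->|/eqP->//] /esym/orP[/eqP->|/eqP->].
have injr z : injective (fun w : G => [set w; z]).
  by move=> w w'; rewrite ![[set _; z]]setUC => /injl.
move=> /(_ (injl u) (injr v)); rewrite -cardE => bound.
apply: leq_trans (bound _).
  rewrite leq_mul2l subset_leq_card ?orbT //; apply/subsetP => f.
  rewrite !inE => /forall_inP h; apply/allP => w; rewrite mem_enum => /h.
  have eqN (b c : bool) : (b == ~~ c) = b (+) c by case: b; case: c.
  by rewrite !eqN.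
(* If [[set u; w]] were [[set w'; v]], then [u] would be [w'] or [v]. *)
move=> w w'; rewrite !mem_enum => _ /midpoint_neq/andP[w'u _].
by apply/eqP => /setP/(_ u); rewrite !inE eqxx (negbTE uv) [u == w']eq_sym (negbTE w'u).
Qed.

(** The two sets that meet in [midpoints u v] have at least [deg u - indeg u] and [deg v - outdeg v]
    elements; inclusion-exclusion inside [G] bounds their overlap from below. *)
Lemma card_midpoints u v :
  (deg u + deg v <= #|midpoints u v| + indeg u + outdeg v + #|G|)%N.
Proof.
have hu : (deg u <= #|out_nbh u :|: und_nbh u| + indeg u)%N.
  by rewrite /deg /nbh setUAC leq_card_setU.
have hv : (deg v <= #|in_nbh v :|: und_nbh v| + outdeg v)%N.
  by rewrite /deg /nbh -setUA setUC leq_card_setU.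
have := cardsUI (out_nbh u :|: und_nbh u) (in_nbh v :|: und_nbh v).
have := subset_leq_card
  (subsetT (out_nbh u :|: und_nbh u :|: (in_nbh v :|: und_nbh v))).
rewrite cardsT -/(midpoints u v); lia.
Qed.

Lemma min_degree_le u : (min_degree G <= deg u)%N.
Proof.
rewrite /min_degree; have := mem_index_enum u.
elim: index_enum => // x s IHs; rewrite inE big_cons geq_min.
by case/orP => [/eqP<-|/IHs->]; rewrite ?leqnn ?orbT.
Qed.

(** Each blocked set holds at most a fraction [1 / #|G|^2] of all outcomes, so these sets, one per
    ordered pair of distinct vertices, cannot cover everything. *)
Lemma exists_unblocked :
  (0 < #|G|)%N ->
  (forall u v, u != v ->
     #|G| ^ 2 * 3 ^ #|midpoints u v| <= 4 ^ #|midpoints u v|)%N ->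
  exists f, forall u v, u != v -> f \notin blocked u v.
Proof.
move=> n0 hM.
have small u v : u != v -> (#|G| ^ 2 * #|blocked u v| <= 2 ^ #|{: {set G}}|)%N.
  move=> uv; have k0 : (0 < 4 ^ #|midpoints u v|)%N by rewrite expn_gt0.
  rewrite -(leq_pmul2l k0) mulnCA.
  apply: leq_trans (leq_mul (leqnn _) (card_blocked _ _ uv)) _.
  by rewrite mulnA leq_mul ?hM.
have [/existsP[f /forallP hf]|] :=
  boolP [exists f, forall u, forall v, (u != v) ==> (f \notin blocked u v)].
  by exists f => u v uv; have /forallP/(_ v) := hf u; rewrite uv.
rewrite negb_exists => /forallP all_blocked.
have cover : [set: {set {set G}}] \subset
    \bigcup_(p : G * G | p.1 != p.2) blocked p.1 p.2.
  apply/subsetP => f _; have := all_blocked f; rewrite negb_forall.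
  case/existsP => u; rewrite negb_forall => /existsP[v].
  rewrite negb_imply negbK => /andP[uv fuv].
  by apply/bigcupP; exists (u, v).
have sum_card : (#|\bigcup_(p : G * G | p.1 != p.2) blocked p.1 p.2|
    <= \sum_(p : G * G | p.1 != p.2) #|blocked p.1 p.2|)%N.
  elim/big_rec2: _ => [|p k B _ le]; first by rewrite cards0.
  by apply: leq_trans (leq_card_setU _ _) _; rewrite leq_add2l.
have := leq_trans (subset_leq_card cover) sum_card.
rewrite -powersetT card_powerset cardsT => le_sum.
have : (#|G| ^ 2 * 2 ^ #|{: {set G}}| <=
        #|[pred p : G * G | p.1 != p.2]| * 2 ^ #|{: {set G}}|)%N.
  rewrite -sum_nat_const; apply: leq_trans (leq_mul (leqnn _) le_sum) _.
  by rewrite big_distrr /=; apply: leq_sum => p; exact: small.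
rewrite leq_pmul2r ?expn_gt0 // -mulnn -card_prod leqNgt => /negP[].
(* The diagonal pair [(u, u)] makes the number of pairs strictly less than [#|G|^2]. *)
have /card_gt0P[u _] := n0.
by apply: proper_card; apply/properP; split; [exact/subsetP|exists (u, u)];
  rewrite // !inE eqxx.
Qed.

Lemma orient_reach f u v : u != v -> f \notin blocked u v ->
  (ddist (orient f) u v <= 2)%N /\ connect (darc (orient f)) u v.
Proof.
move=> uv; rewrite inE negb_forall => /existsP[w].
rewrite negb_imply negbK => /and3P[wM uw wv].
have /andP[wu wv'] := midpoint_neq _ _ _ wM.
have /andP[uwD wvD] := midpoint_path _ _ _ _ wM uw wv.
split; first exact: ddist_le2 uwD wvD.
by apply: (connect_trans (y := w)); apply: connect1.
Qed.

Lemma oriented_diameter_eq2 f :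
  (1 < #|G|)%N -> (forall u v, u != v -> f \notin blocked u v) ->
  oriented_diameter G = Some 2%N.
Proof.
move=> n1 hf.
have strong_f : strong_orientation (orient f).
  rewrite /strong_orientation orient_orientation; apply/forallP => u.
  apply/forallP => v; have [->|uv] := eqVneq u v; first exact: connect0.
  by have [] := orient_reach _ _ _ uv (hf _ _ uv).
have diam_f : (diameter (orient f) <= 2)%N.
  apply/bigmax_leqP => u _; apply/bigmax_leqP => v uv.
  by have [] := orient_reach _ _ _ uv (hf _ _ uv).
(* The picked [D0] only seeds the minimum, which [orient f] bounds by 2 from above. *)
rewrite /oriented_diameter; case: pickP => [D0 sD0|/(_ (orient f))]; last first.
  by rewrite strong_f.
case: arg_minnP => // D /andP[oD _] minD; congr Some; apply/eqP.
rewrite eqn_leq (leq_trans (minD _ strong_f)) //=.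
by apply: diameter_ge2 => // x y; exact: orientation_asym.
Qed.

End RandomOrientation.

(** * From the degree hypothesis to the conclusion *)

Lemma exp_le_of_ln_le (R : realType) (n k : nat) :
  (0 < n)%N -> 2 * (ln n%:R / ln (4 / 3)) <= k%:R :> R ->
  (n ^ 2 * 3 ^ k <= 4 ^ k)%N.
Proof.
move=> n0 hk.
have n0R : 0 < n%:R :> R by rewrite ltr0n.
have q1 : 1 < 4 / 3 :> R by lra.
have q0 : 0 < 4 / 3 :> R by lra.
have : ln (n%:R ^+ 2) <= ln ((4 / 3) ^+ k) :> R.
  rewrite !lnXn // -[leRHS]mulr_natl -[leLHS]mulr_natl.
  by rewrite -ler_pdivrMr ?ln_gt0 // -mulrA.
rewrite ler_ln ?posrE ?exprn_gt0 // expr_div_n.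
by rewrite ler_pdivlMr ?exprn_gt0 // -!natrX -natrM ler_nat.
Qed.

Theorem theorem2p1 (R : realType) (c1 c2 : rat) (G : mixed_graph)
  (hc1 : 0 <= c1 <= 1) (hc2 : 0 <= c2 <= 1)
  (hc : 2 - c1 - c2 != 0)
  (hG : (0 < #|G|)%N)
  (hmixed : c_mixed G c1 c2)
  (hdelta : 1 / (2 - ratr c1 - ratr c2) * #|G|%:R
            + 2 / (2 - ratr c1 - ratr c2) * (ln #|G|%:R / ln (4 / 3))
            <= (min_degree G)%:R :> R) :
  oriented_diameter G = Some 2%N.
Proof.
have c0 : 0 < 2 - c1 - c2 by rewrite lt0r hc; lra.
have cE : ratr (2 - c1 - c2) = 2 - ratr c1 - ratr c2 :> R.
  by rewrite !rmorphB /= ratr_nat.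
have c0R : 0 < 2 - ratr c1 - ratr c2 :> R by rewrite -cE ltr0q.
have hdelta' : #|G|%:R + 2 * (ln #|G|%:R / ln (4 / 3))
    <= (2 - ratr c1 - ratr c2) * (min_degree G)%:R :> R.
  rewrite [leRHS]mulrC -ler_pdivrMr //; apply: le_trans _ hdelta.
  by rewrite mulrDl mul1r [_^-1 * _]mulrC [2 / _ * _]mulrAC.
have hM (u v : G) : u != v ->
    (#|G| ^ 2 * 3 ^ #|midpoints G u v| <= 4 ^ #|midpoints G u v|)%N.
  move=> uv; apply: (@exp_le_of_ln_le R) => //.
  (* Proved in [rat], where [c_mixed] lives, then sent to [R] by [ratr]: add
     [(1 - c2) * deg u <= deg u - indeg u] and [(1 - c1) * deg v <= deg v - outdeg v], and bound
     both degrees below by [min_degree G]. *)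
  have : (2 - c1 - c2) * (min_degree G)%:R
      <= #|midpoints G u v|%:R + #|G|%:R :> rat.
    have := card_midpoints G u v; rewrite -(ler_nat rat) !natrD.
    have [_] := hmixed u; have [+ _] := hmixed v.
    have := min_degree_le G u; have := min_degree_le G v; rewrite -!(ler_nat rat).
    nra.
  rewrite -(ler_rat R) rmorphM /= cE rmorphD /= !ratr_nat => h.
  by have := le_trans hdelta' h; rewrite addrC lerD2r.
have [f hf] := exists_unblocked G hG hM.
apply: oriented_diameter_eq2 hf.
(* A single vertex has degree 0 and [ln 1 = 0], so [hdelta'] would read [1 <= 0]. *)
rewrite ltn_neqAle hG andbT; apply/eqP => n1.
have /card_gt0P[u _] := hG.
have d0 : deg u = 0%N.
  apply/eqP; rewrite cards_eq0; apply/eqP/setP => w.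
  have -> : w = u by have /fintype_le1P := eq_leq (esym n1); apply.
  by rewrite !inE !arc_irrefl edge_irrefl.
have := min_degree_le G u; rewrite d0 leqn0 => /eqP m0.
by move: hdelta'; rewrite -n1 m0 ln1 mul0r !mulr0 addr0 ler10.
Qed.
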